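(* Every Bieberbach manifold with a cyclic holonomy group of odd order is the totally geodesic boundary of a compact flat manifold.
   Context: All manifolds are assumed connected. A Bieberbach group in dimension $m$ is a discrete, co-compact group $\Gamma$ of affine isometries of $\mathbb{R}^m$ acting without fixed points; a Bieberbach manifold is the quotient $\mathbb{R}^m/\Gamma$ with the induced flat metric. The translations in $\Gamma$ form a normal subgroup $\Lambda$ of finite index, which is a lattice of $\mathbb{R}^m$; the finite group $G=\Gamma/\Lambda$ is the holonomy group of $\mathbb{R}^m/\Gamma$. A Bieberbach manifold $N$ of dimension $m$ is the totally geodesic boundary of a compact flat manifold if there is a compact flat Riemannian manifold $M$ of dimension $m+1$ with totally geodesic boundary $\partial M$ isometric to $N$. *)

(* Defs.v *)
From HB Require Import structures.
From mathcomp Require Import all_boot all_order all_algebra.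
From mathcomp Require Import all_classical all_reals all_analysis.

Set Implicit Arguments.
Unset Strict Implicit.
Unset Printing Implicit Defensive.

Import Order.TTheory GRing.Theory Num.Theory.
Import numFieldNormedType.Exports.

Local Open Scope classical_set_scope.
Local Open Scope ring_scope.

(** * Affine isometries and Bieberbach groups *)

(** The pair (A, a) stands for the affine map x |-> x A + a of row vectors;
    the space of pairs carries the product topology. *)
Definition aff_act (R : realType) (m : nat) (u : 'M[R]_m * 'rV[R]_m)
    (x : 'rV[R]_m) : 'rV[R]_m := x *m u.1 + u.2.

Definition aff_id (R : realType) (m : nat) : 'M[R]_m * 'rV[R]_m :=
  (1%:M, 0).

(** [aff_mul u v] acts as "first v, then u". *)
Definition aff_mul (R : realType) (m : nat) (u v : 'M[R]_m * 'rV[R]_m) :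
  'M[R]_m * 'rV[R]_m := (v.1 *m u.1, v.2 *m u.1 + u.2).

Record bieberbach_group (R : realType) (m : nat)
    (G : set ('M[R]_m * 'rV[R]_m)) : Prop := BieberbachGroup {
  bieb_isometry : forall u, G u -> u.1 *m u.1^T = 1%:M;
  bieb_id : G (aff_id R m);
  bieb_mul : forall u v, G u -> G v -> G (aff_mul u v);
  bieb_inv : forall u, G u -> exists2 v, G v & aff_mul v u = aff_id R m;
  bieb_discrete : isolated G = G;
  bieb_cocompact : exists2 K : set 'rV[R]_m, compact K &
    forall x, exists2 u, G u & K (aff_act u x);
  bieb_free : forall u x, G u -> aff_act u x = x -> u = aff_id R m }.

Definition translations (R : realType) (m : nat)
    (G : set ('M[R]_m * 'rV[R]_m)) : set ('M[R]_m * 'rV[R]_m) :=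
  [set u | G u /\ u.1 = 1%:M].

Definition translation_coset (R : realType) (m : nat)
    (G : set ('M[R]_m * 'rV[R]_m)) (u : 'M[R]_m * 'rV[R]_m) :
  set ('M[R]_m * 'rV[R]_m) := [set aff_mul u t | t in translations G].

Definition holonomy (R : realType) (m : nat)
    (G : set ('M[R]_m * 'rV[R]_m)) : set (set ('M[R]_m * 'rV[R]_m)) :=
  [set translation_coset G u | u in G].

(** Nonnegative powers of the generator suffice because the group is finite. *)
Definition holonomy_cyclic_of_order (R : realType) (m : nat)
    (G : set ('M[R]_m * 'rV[R]_m)) (k : nat) : Prop :=
  (holonomy G #= `I_k)%card /\
  exists2 u, G u & forall C, holonomy G C ->
    exists j : nat, C = translation_coset G (iter j (aff_mul u) (aff_id R m)).

Definition orbit_of (R : realType) (m : nat) (G : set ('M[R]_m * 'rV[R]_m))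
    (x : 'rV[R]_m) : set 'rV[R]_m := [set aff_act u x | u in G].

Definition orbit_space (R : realType) (m : nat)
    (G : set ('M[R]_m * 'rV[R]_m)) : Type :=
  {A : set 'rV[R]_m | exists x, A = orbit_of G x}.

Definition orbit_proj (R : realType) (m : nat) (G : set ('M[R]_m * 'rV[R]_m))
    (x : 'rV[R]_m) : orbit_space G :=
  exist _ (orbit_of G x) (ex_intro _ x erefl).

(** * Smooth functions on open sets and on subsets of the half-space *)

(** C^oo on the open set V: every iterated partial derivative of f is
    differentiable at every point of V. *)
Definition smooth_on (R : realType) (n : nat) (V : set 'rV[R]_n)
    (f : 'rV[R]_n -> R) : Prop :=
  forall (s : seq 'I_n) (x : 'rV[R]_n), V x ->
    differentiable (foldr (fun i (h : 'rV[R]_n -> R) =>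
      (fun y => 'D_(delta_mx 0 i) h y)) f s) x.

Definition smooth_map_on (R : realType) (n p : nat) (V : set 'rV[R]_n)
    (f : 'rV[R]_n -> 'rV[R]_p) : Prop :=
  forall j, smooth_on V (fun x => f x 0 j).

Definition half_space (R : realType) (m : nat) : set 'rV[R]_m.+1 :=
  [set x | 0 <= x 0 ord_max].

Definition smooth_within (R : realType) (n : nat) (A : set 'rV[R]_n)
    (f : 'rV[R]_n -> R) : Prop :=
  forall x, A x -> exists V (g : 'rV[R]_n -> R),
    [/\ open V, V x, smooth_on V g & forall y, V y -> A y -> g y = f y].

Definition smooth_map_within (R : realType) (n p : nat) (A : set 'rV[R]_n)
    (f : 'rV[R]_n -> 'rV[R]_p) : Prop :=
  forall j, smooth_within A (fun x => f x 0 j).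

(** Right partial derivative.  At a point x of the half-space, x + h e_i stays
    in the half-space for h >= 0; hence, for f smooth on a relatively open
    subset of the half-space, this only depends on f there, and it is the
    ordinary partial derivative at x of any local smooth extension of f. *)
Definition partial (R : realType) (n : nat) (i : 'I_n) (f : 'rV[R]_n -> R)
    (x : 'rV[R]_n) : R :=
  lim (h^-1 * (f (x + h *: delta_mx 0 i) - f x) @[h --> 0^'+]).

(** Same convention as [jacobian]: row vectors are mapped by v |-> v J. *)
Definition partial_jacobian (R : realType) (n p : nat)
    (f : 'rV[R]_n -> 'rV[R]_p) (x : 'rV[R]_n) : 'M[R]_(n, p) :=
  \matrix_(i, j) partial i (fun y => f y 0 j) x.

(** * Riemannian manifolds with boundary *)

(** A smooth Riemannian manifold of dimension m + 1, with (possibly empty)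
    boundary, on the topological space M.  [phi c] is a chart on [dom c] with
    values in the half-space, [psi c] its inverse, and [metric c x] the Gram
    matrix at x of the coordinate vector fields; these total functions are
    only meaningful on [dom c], resp. on the image of [dom c]. *)
Record riemannian_manifold (R : realType) (m : nat) (M : topologicalType) :=
  RiemannianManifold {
  chart : Type;
  dom : chart -> set M;
  phi : chart -> M -> 'rV[R]_m.+1;
  psi : chart -> 'rV[R]_m.+1 -> M;
  metric : chart -> 'rV[R]_m.+1 -> 'M[R]_m.+1;
  mfd_hausdorff : hausdorff_space M;
  mfd_second_countable : @second_countable M;
  dom_open : forall c, open (dom c);
  dom_cover : forall p, exists c, dom c p;
  phiK : forall c p, dom c p -> psi c (phi c p) = p;
  phi_continuous : forall c p, dom c p -> {for p, continuous (phi c)};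
  phi_open : forall c U, open U -> U `<=` dom c ->
    exists2 V, open V & phi c @` U = V `&` @half_space R m;
  transition_smooth : forall c d,
    smooth_map_within (phi c @` (dom c `&` dom d)) (phi d \o psi c);
  metric_sym : forall c p, dom c p ->
    (metric c (phi c p))^T = metric c (phi c p);
  metric_pos : forall c p (v : 'rV[R]_m.+1), dom c p -> v != 0 ->
    0 < (v *m metric c (phi c p) *m v^T) 0 0;
  metric_smooth : forall c a b,
    smooth_within (phi c @` dom c) (fun x => metric c x a b);
  metric_transition : forall c d p, dom c p -> dom d p ->
    let J := partial_jacobian (phi d \o psi c) (phi c p) in
    metric c (phi c p) = J *m metric d (phi d p) *m J^T }.

Definition boundary (R : realType) (m : nat) (M : topologicalType)
    (X : riemannian_manifold R m M) : set M :=
  [set p | exists2 c : chart X, dom c p & phi c p 0 ord_max = 0].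

(** The Christoffel symbol Gamma^k_{ab} of the Levi-Civita connection. *)
Definition christoffel (R : realType) (n : nat) (g : 'rV[R]_n -> 'M[R]_n)
    (k a b : 'I_n) (x : 'rV[R]_n) : R :=
  2^-1 * \sum_(l < n) invmx (g x) k l *
    (partial a (fun y => g y l b) x + partial b (fun y => g y l a) x
     - partial l (fun y => g y a b) x).

(** The component R^d_{cab} of the Riemann tensor, i.e. the coefficient of
    d/dx_d in R(d/dx_a, d/dx_b) d/dx_c. *)
Definition riemann_curvature (R : realType) (n : nat)
    (g : 'rV[R]_n -> 'M[R]_n) (d c a b : 'I_n) (x : 'rV[R]_n) : R :=
  partial a (christoffel g d b c) x - partial b (christoffel g d a c) x
  + \sum_(e < n) (christoffel g d a e x * christoffel g e b c x
                  - christoffel g d b e x * christoffel g e a c x).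

Definition flat (R : realType) (m : nat) (M : topologicalType)
    (X : riemannian_manifold R m M) : Prop :=
  forall (c : chart X) p i j a b, dom c p ->
    riemann_curvature (metric c) i j a b (phi c p) = 0.

(** For a, b different from the last index n, the number
    <nabla_{d/dx_a} d/dx_b, nu> at a boundary point: the inward unit normal is
    nu = sum_k g^{nk} d/dx_k / sqrt (g^{nn}), so that <d/dx_k, nu> vanishes
    for k <> n and is 1 / sqrt (g^{nn}) for k = n. *)
Definition second_fundamental_form (R : realType) (m : nat)
    (g : 'rV[R]_m.+1 -> 'M[R]_m.+1) (a b : 'I_m.+1) (x : 'rV[R]_m.+1) : R :=
  christoffel g ord_max a b x / Num.sqrt (invmx (g x) ord_max ord_max).

Definition totally_geodesic_boundary (R : realType) (m : nat)
    (M : topologicalType) (X : riemannian_manifold R m M) : Prop :=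
  forall (c : chart X) p a b, dom c p -> phi c p 0 ord_max = 0 ->
    a != ord_max -> b != ord_max ->
    second_fundamental_form (metric c) a b (phi c p) = 0.

(** [F] is an isometry from the Riemannian manifold R^m / G onto the boundary
    of X with the metric induced by X.  The charts of R^m / G are the local
    inverses of [orbit_proj G], so smoothness of F is that of
    [F \o orbit_proj G], and the flat metric of R^m / G is the Euclidean one in
    these charts.  The last clause is smoothness of the inverse of F. *)
Definition boundary_isometry (R : realType) (m : nat)
    (G : set ('M[R]_m * 'rV[R]_m)) (M : topologicalType)
    (X : riemannian_manifold R m M) (F : orbit_space G -> M) : Prop :=
  let f := F \o @orbit_proj R m G in
  [/\ injective F,
      range F = boundary X,
      forall (c : chart X) x, dom c (f x) -> exists V : set 'rV[R]_m,
        [/\ open V, V x, f @` V `<=` dom c & smooth_map_on V (phi c \o f)],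
      forall (c : chart X) x, dom c (f x) ->
        let J := jacobian (phi c \o f) x in
        J *m metric c (phi c (f x)) *m J^T = 1%:M &
      forall (c : chart X) x, dom c (f x) ->
        exists (V : set 'rV[R]_m.+1) (s : 'rV[R]_m.+1 -> 'rV[R]_m),
        [/\ open V, V (phi c (f x)), smooth_map_on V s, s (phi c (f x)) = x &
            forall p, dom c p -> boundary X p -> V (phi c p) ->
              f (s (phi c p)) = p]].

Definition bounds_compact_flat_manifold (R : realType) (m : nat)
    (G : set ('M[R]_m * 'rV[R]_m)) : Prop :=
  exists (M : topologicalType) (X : riemannian_manifold R m M),
    [/\ compact [set: M], connected [set: M], flat X,
        totally_geodesic_boundary X &
        exists F : orbit_space G -> M, boundary_isometry X F].

(* Main.v *)
(** If G is a Bieberbach group whose holonomy is cyclic of odd order k, then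
    the linear part A of a holonomy generator u fixes a nonzero lattice vector:
    either u^k is a nontrivial translation, whose vector is fixed by A, or u
    has finite order, hence is trivial because it fixes the barycenter of an
    orbit. Halving that vector as long as possible yields w fixed by A such
    that 2w is a lattice vector and w is not. Translation by w commutes with G,
    and if it agreed with some g^-1 at a point, then, computing g^k, the vector
    k w would be a lattice vector, hence so would w, as k is odd. So it induces
    a fixed-point-free isometric involution of N = R^m / G, and the quotient of
    N x [0, 2] by (y, s) |-> (y + w, 2 - s) is a compact flat manifold with
    totally geodesic boundary N. *)
From HB Require Import structures.
Require Import Defs.
From mathcomp Require Import all_boot all_order all_algebra finmap.
From mathcomp Require Import all_classical all_reals all_analysis.

Set Implicit Arguments.
Unset Strict Implicit.
Unset Printing Implicit Defensive.

Import Order.TTheory GRing.Theory Num.Theory.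
Import numFieldNormedType.Exports.

Local Open Scope classical_set_scope.
Local Open Scope ring_scope.

(** * Affine maps and smoothness *)

Lemma mx_entry_le (R : realType) (m n : nat) (A : 'M[R]_(m, n)) i j :
  `|A i j| <= `|A|.
Proof.
rewrite [leRHS]/Num.norm /= mx_normrE; apply/bigmax_geP; right => /=.
by exists (i, j).
Qed.

Lemma mx_norm_le (R : realType) (m n : nat) (A : 'M[R]_(m, n)) (c : R) :
  0 <= c -> (forall i j, `|A i j| <= c) -> `|A| <= c.
Proof.
move=> c0 Ac; rewrite [leLHS]/Num.norm /= mx_normrE; apply/bigmax_leP.
by split => // -[i j] _; exact: Ac.
Qed.

(** The norm is the largest absolute value of an entry, so it is not submultiplicative: an entry of
    the product is a sum of [n] products, whence the factor. *)
Lemma mulmx_norm_le (R : realType) (m n p : nat) (A : 'M[R]_(m, n))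
    (B : 'M[R]_(n, p)) : `|A *m B| <= n%:R * `|A| * `|B|.
Proof.
apply: mx_norm_le => [|i j]; first by rewrite !mulr_ge0.
rewrite mxE; apply: (le_trans (ler_norm_sum _ _ _)).
have -> : n%:R * `|A| * `|B| = \sum_(k < n) `|A| * `|B|.
  by rewrite sumr_const card_ord -mulrA mulr_natl.
by apply: ler_sum => k _; rewrite normrM ler_pM// mx_entry_le.
Qed.

Lemma unitary_norm_le1 (R : realType) (n : nat) (A : 'M[R]_n) :
  A *m A^T = 1%:M -> `|A| <= 1.
Proof.
move=> A1; apply: mx_norm_le => // i j.
have /matrixP/(_ i i) := A1; rewrite !mxE eqxx (bigD1 j)//= mxE => E.
rewrite -(@ler_pXn2r _ 2)// ?nnegrE// expr1n real_normK ?num_real// -[leRHS]E.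
rewrite -expr2 lerDl sumr_ge0// => k _.
by rewrite mxE -expr2 sqr_ge0.
Qed.

Lemma mulmxr_continuous (R : realType) (m n p : nat) (A : 'M[R]_(n, p)) :
  continuous (fun x : 'M[R]_(m, n) => x *m A).
Proof.
apply: (@linear_bounded_continuous _ _ _ (mulmxr A)).1.
apply/linear_boundedP; near=> r => x /=.
rewrite (le_trans (mulmx_norm_le _ _))// mulrAC ler_wpM2r//.
Unshelve. all: by end_near. Qed.

Lemma aff_act_continuous (R : realType) (n : nat) (u : 'M[R]_n * 'rV[R]_n) :
  continuous (aff_act u).
Proof.
move=> x; apply: (@cvgD _ _ _ (nbhs x)).
  exact: mulmxr_continuous.
exact: cvg_cst.
Qed.

(** [f] agrees with an affine map near [x], so its remainder term vanishes. *)
Lemma near_affine_diff (R : realType) (V W : normedModType R)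
    (L : {linear V -> W}) (c : W) (f : V -> W) (x : V) :
  continuous L -> (\near x, f x = L x + c) ->
  differentiable f x /\ 'd f x = L :> (V -> W).
Proof.
move=> Lc fL.
have E : f \o shift x = cst (f x) + L +o_ 0 id.
  apply/eqaddoP => e e0.
  have /nbhs0P fL0 := fL; near=> h; rewrite !fctE /= [h + x]addrC.
  have -> : f (x + h) = L (x + h) + c by near: h.
  rewrite (nbhs_singleton fL) linearD [L x + L h + c]addrAC subrr normr0.
  by rewrite mulr_ge0// ltW.
have dE : 'd f x = L :> (V -> W) by exact: diff_unique.
split => //; apply/diff_locallyP.
by split; rewrite dE.
Unshelve. all: by end_near. Qed.

(** Iterated partial derivatives stay affine on [V], by induction on the list of directions. As [V]
    is open, agreement on [V] is agreement near each of its points, which is all that a derivative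
    sees. *)
Lemma smooth_on_affine (R : realType) (n : nat) (V : set 'rV[R]_n)
    (f : 'rV[R]_n -> R) (A : 'cV[R]_n) (b : R) :
  open V -> (forall y, V y -> f y = (y *m A) 0 0 + b) -> smooth_on V f.
Proof.
move=> oV fA s.
have lin (B : 'cV[R]_n) : exists2 L : {linear 'rV[R]_n -> R^o},
    continuous L & forall y, L y = (y *m B) 0 0.
  have LP : linear (fun y : 'rV[R]_n => (y *m B) 0 0 : R^o).
    by move=> a x y; rewrite mulmxDl -scalemxAl !mxE.
  pose Lm := GRing.isLinear.Build R 'rV[R]_n R^o *:%R _ LP.
  pose L : {linear 'rV[R]_n -> R^o} :=
    HB.pack (fun y : 'rV[R]_n => (y *m B) 0 0 : R^o) Lm.
  exists L => // y.
  apply: (@continuous_comp _ _ _ (fun y : 'rV[R]_n => y *m B)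
            (fun M : 'M[R]_1 => M 0 0)).
    exact: mulmxr_continuous.
  exact: coord_continuous.
have diffn g (B : 'cV[R]_n) c x : V x ->
    (forall y, V y -> g y = (y *m B) 0 0 + c) ->
    differentiable (g : 'rV[R]_n -> R^o) x /\
    forall i, 'D_(delta_mx 0 i) (g : 'rV[R]_n -> R^o) x = B i 0.
  move=> Vx gB; have [L Lc LE] := lin B.
  have [|dg dgE] := @near_affine_diff R _ _ L c g x Lc.
    by near=> y; rewrite LE gB//; near: y; exact: open_nbhs_nbhs.
  split=> // i; rewrite deriveE// dgE LE.
  by rewrite -rowE mxE.
have [B [c fB]] : exists (B : 'cV[R]_n) (c : R), forall y, V y ->
    foldr (fun i (h : 'rV[R]_n -> R) => (fun y => 'D_(delta_mx 0 i) h y)) f s y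
    = (y *m B) 0 0 + c.
  elim: s => [|i s [B [c IH]]] /=; first by exists A, b.
  (* A derivative of an affine function is constant: its linear part is 0. *)
  exists 0, (B i 0) => y Vy; rewrite mulmx0 mxE add0r.
  by have [_ ->] := diffn _ _ _ _ Vy IH.
by move=> x Vx; have [] := diffn _ _ _ _ Vx fB.
Unshelve. all: by end_near. Qed.

Lemma smooth_map_on_affine (R : realType) (n p : nat) (V : set 'rV[R]_n)
    (f : 'rV[R]_n -> 'rV[R]_p) (A : 'M[R]_(n, p)) (b : 'rV[R]_p) :
  open V -> (forall y, V y -> f y = y *m A + b) -> smooth_map_on V f.
Proof.
move=> oV fA j; apply: (@smooth_on_affine _ _ _ _ (col j A) (b 0 j)) => // y Vy.
by rewrite fA// !mxE; congr (_ + _); apply: eq_bigr => k _; rewrite mxE.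
Qed.

Lemma jacobian_affine (R : realType) (n p : nat) (V : set 'rV[R]_n)
    (f : 'rV[R]_n -> 'rV[R]_p) (A : 'M[R]_(n, p)) (b : 'rV[R]_p) x :
  open V -> V x -> (forall y, V y -> f y = y *m A + b) -> jacobian f x = A.
Proof.
move=> oV Vx fA; apply/row_matrixP => i; rewrite 2!rowE mul_rV_lin1.
have [||_ ->//] := @near_affine_diff R _ _ (mulmxr A) b f x.
  exact: mulmxr_continuous.
by near=> y; rewrite fA//; near: y; exact: open_nbhs_nbhs.
Unshelve. all: by end_near. Qed.

(** * Right partial derivatives and the curvature of a constant metric *)

Lemma partial_affine (R : realType) (n : nat) (i : 'I_n) (f : 'rV[R]_n -> R)
    (x : 'rV[R]_n) (a : R) :
  (\forall h \near 0^'+, f (x + h *: delta_mx 0 i) = f x + h * a) ->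
  partial i f x = a.
Proof.
move=> fa; apply: cvg_lim => //.
apply: cvg_trans (@cvg_cst _ a _ (0 : R)^'+ _).
apply: near_eq_cvg; near=> h.
have h0 : h != 0 by rewrite gt_eqF//; near: h; exact: nbhs_right_gt.
have -> : f (x + h *: delta_mx 0 i) = f x + h * a by near: h.
by rewrite addrAC subrr add0r mulKf.
Unshelve. all: by end_near. Qed.

Lemma partial_cst (R : realType) (n : nat) (i : 'I_n) (a : R) x :
  partial i (fun=> a) x = 0.
Proof. by apply: partial_affine; near=> h; rewrite mulr0 addr0.
Unshelve. all: by end_near. Qed.

Lemma christoffel_cst (R : realType) (n : nat) (g : 'M[R]_n) k a b x :
  christoffel (fun=> g) k a b x = 0.
Proof.
rewrite /christoffel big1 ?mulr0// => l _.
by rewrite !partial_cst !add0r oppr0 mulr0.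
Qed.

Lemma riemann_curvature_cst (R : realType) (n : nat) (g : 'M[R]_n) d c a b x :
  riemann_curvature (fun=> g) d c a b x = 0.
Proof.
rewrite /riemann_curvature.
have E k i j : christoffel (fun=> g) k i j = fun=> 0.
  by apply/funext => y; rewrite christoffel_cst.
rewrite !E !partial_cst subrr add0r big1// => e _.
by rewrite !christoffel_cst !mul0r subrr.
Qed.

(** * Second countability and connectedness of the Euclidean space *)

Lemma rV_second_countable (R : realType) (n : nat) :
  @second_countable 'rV[R]_n.
Proof.
pose Bf (q : 'rV[rat]_n * nat) : set 'rV[R]_n :=
  ball (map_mx ratr q.1 : 'rV[R]_n) (q.2.+1%:R^-1 : R).
exists (range Bf); first exact: (sub_countable (card_image_le _ _)).
split=> [_ [q _ <-]|x A /nbhs_ballP[e /= e0 eA]].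
  by apply: ball_open; rewrite /= invr_gt0 ltr0n.
have e2 : 0 < 2^-1 * e by rewrite mulr_gt0.
near \oo => k.
(* A ball of radius [1 / (k + 1)] that contains [x] lies within twice that radius of [x], hence in
   the ball of radius [e]. *)
have ke : 2 * k.+1%:R^-1 < e :> R.
  rewrite -ltr_pdivlMl//; near: k.
  exact: (near_infty_natSinv_lt (PosNum e2)).
have k0 : 0 < k.+1%:R^-1 :> R by rewrite invr_gt0.
have q_ex i : exists q : rat, ball (x 0 i) (k.+1%:R^-1 : R) (ratr q).
  have [||y [xy [q _ qy]]] := @dense_rat R (ball (x 0 i) (k.+1%:R^-1 : R)).
  - by exists (x 0 i); exact: ballxx.
  - exact: ball_open.
  by exists q; rewrite qy.
have [q qx] := choice q_ex.
exists (Bf (\row_i q i, k)).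
  split; first by exists (\row_i q i, k).
  by split => // i j; rewrite !mxE ord1; apply/ball_sym; exact: qx.
move=> y yB; apply: eA.
apply: (@le_ball _ _ _ (k.+1%:R^-1 + k.+1%:R^-1)).
  by move: ke; rewrite mulr_natl mulr2n => /ltW.
apply: ball_triangle yB.
by split => // i j; rewrite !mxE ord1; exact: qx.
Unshelve. all: by end_near. Qed.

Lemma rV_connected (R : realType) (n : nat) : connected [set: 'rV[R]_n].
Proof.
have -> : [set: 'rV[R]_n] =
    \bigcup_(x : 'rV[R]_n) ((fun t : R => t *: x) @` `[0, 1]%classic).
  apply/seteqP; split => // x _; exists x => //.
  exists 1; last by rewrite scale1r.
  by rewrite /= in_itv/= ler01 lexx.
apply: bigcup_connected => [|x _].
  exists 0 => x _; exists 0; last by rewrite scale0r.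
  by rewrite /= in_itv/= ler01 lexx.
apply: connected_continuous_connected; first exact: segment_connected.
apply: continuous_subspaceT => t.
exact: scalel_continuous.
Qed.

(** * Quotient of a slab by a group of isometries *)

Lemma aff_act_id (R : realType) (n : nat) (x : 'rV[R]_n) :
  aff_act (aff_id R n) x = x.
Proof. by rewrite /aff_act mulmx1 addr0. Qed.

Lemma aff_actM (R : realType) (n : nat) (u v : 'M[R]_n * 'rV[R]_n) x :
  aff_act (aff_mul u v) x = aff_act u (aff_act v x).
Proof. by rewrite /aff_act /= mulmxDl mulmxA addrA. Qed.

(** The maps preserve the Euclidean norm, whereas distances here are taken in the sup norm; this
    costs a factor [n]. *)
Lemma aff_act_dist (R : realType) (n : nat) (u : 'M[R]_n * 'rV[R]_n) x y :
  u.1 *m u.1^T = 1%:M -> `|aff_act u x - aff_act u y| <= n%:R * `|x - y|.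
Proof.
move=> u1; rewrite /aff_act opprD addrACA subrr addr0 -mulmxBl.
apply: (le_trans (mulmx_norm_le _ _)).
by rewrite ler_piMr ?mulr_ge0// unitary_norm_le1.
Qed.

(** What a group acting on the slab [0 <= s <= 2] must satisfy for the quotient to be a compact flat
    manifold, where [s] is the last coordinate. An element satisfying [slab_flip] glues the face
    [s = 2] to the face [s = 0], so that the boundary of the quotient is the image of the latter
    alone. *)
Record slab_group (R : realType) (m : nat)
    (H : set ('M[R]_m.+1 * 'rV[R]_m.+1)) : Prop := SlabGroup {
  slab_isometry : forall u, H u -> u.1 *m u.1^T = 1%:M;
  slab_id : H (aff_id R m.+1);
  slab_mul : forall u v, H u -> H v -> H (aff_mul u v);
  slab_inv : forall u, H u -> exists2 v, H v & aff_mul v u = aff_id R m.+1;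
  slab_last : forall u, H u ->
    (forall x, aff_act u x 0 ord_max = x 0 ord_max) \/
    (forall x, aff_act u x 0 ord_max = 2 - x 0 ord_max);
  slab_flip : exists2 u, H u & forall x,
    aff_act u x 0 ord_max = 2 - x 0 ord_max;
  slab_free : forall u (x : 'rV[R]_m.+1), H u -> aff_act u x = x ->
    u = aff_id R m.+1;
  slab_discrete : forall x y : 'rV[R]_m.+1, exists2 r : R, 0 < r &
    forall u, H u -> ball y r (aff_act u x) -> aff_act u x = y;
  slab_cocompact : exists2 K : set 'rV[R]_m.+1, compact K &
    forall x : 'rV[R]_m.+1, 0 <= x 0 ord_max <= 2 ->
      exists2 u, H u & K (aff_act u x) }.

Section SlabQuotient.
Variables (R : realType) (m : nat) (H : set ('M[R]_m.+1 * 'rV[R]_m.+1)).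
Hypothesis HG : slab_group H.
Local Notation E := 'rV[R]_m.+1.
Implicit Types (x y z : E) (u v : 'M[R]_m.+1 * 'rV[R]_m.+1).

Definition slab : set E := [set x | 0 <= x 0 ord_max <= 2].

(** Retraction onto the slab: its composite with the orbit map presents the
    quotient of the slab as a quotient of the whole space. *)
Definition clamp x : E :=
  x + (Num.max 0 (Num.min 2 (x 0 ord_max)) - x 0 ord_max) *: delta_mx 0 ord_max.

Lemma clamp_slab x : slab (clamp x).
Proof.
rewrite /slab /= !mxE !eqxx mulr1 addrC subrK.
rewrite le_max lexx /= ge_max ge_min lexx /=.
by rewrite ler0n.
Qed.

Lemma clamp_id x : slab x -> clamp x = x.
Proof.
move=> /andP[x0 x2]; rewrite /clamp min_r// max_r//.
by rewrite subrr scale0r addr0.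
Qed.

Lemma last_continuous : continuous (fun x : E => x 0 ord_max).
Proof. exact: coord_continuous. Qed.

Lemma clamp_continuous : continuous clamp.
Proof.
move=> x; apply: (@cvgD _ _ _ (nbhs x)); first exact: cvg_id.
apply: (@cvgZr_tmp _ _ _ (nbhs x)).
apply: (@cvgB _ R^o _ (nbhs x)); last exact: last_continuous.
apply: (@continuous_max _ _ (cst 0) (fun x : E => Num.min 2 (x 0 ord_max)) x).
  exact: cst_continuous.
apply: (@continuous_min _ _ (cst 2) (fun x : E => x 0 ord_max) x).
  exact: cst_continuous.
exact: last_continuous.
Qed.

Lemma slab_act u x : H u -> slab x -> slab (aff_act u x).
Proof.
move=> Hu /andP[x0 x2]; have [E|E] := slab_last HG Hu; rewrite /slab /= E.
  by rewrite x0.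
by rewrite subr_ge0 x2 lerBlDr lerDl.
Qed.

Definition slab_rel : rel E :=
  fun x y => `[< exists2 u, H u & aff_act u (clamp x) = clamp y >].

Lemma slab_rel_refl : reflexive slab_rel.
Proof.
move=> x; apply/asboolP; exists (aff_id R m.+1); first exact: slab_id.
by rewrite aff_act_id.
Qed.

Lemma slab_rel_sym : symmetric slab_rel.
Proof.
have S x y : slab_rel x y -> slab_rel y x.
  move=> /asboolP[u Hu E]; apply/asboolP; have [v Hv vu] := slab_inv HG Hu.
  by exists v => //; rewrite -E -aff_actM vu aff_act_id.
by move=> x y; apply/idP/idP; exact: S.
Qed.

Lemma slab_rel_trans : transitive slab_rel.
Proof.
move=> y x z /asboolP[u Hu uE] /asboolP[v Hv vE]; apply/asboolP.
by exists (aff_mul v u); [exact: slab_mul|rewrite aff_actM uE vE].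
Qed.

Definition slab_equiv : equiv_rel E :=
  EquivRel slab_rel slab_rel_refl slab_rel_sym slab_rel_trans.

Definition slab_quotient : topologicalType :=
  quotient_topology {eq_quot slab_equiv}%qT.
Local Notation M := slab_quotient.

Definition slab_pr (x : E) : M :=
  (\pi_(quotient_topology {eq_quot slab_equiv}%qT) x)%qT.

Lemma slab_prE x y :
  slab_pr x = slab_pr y <-> exists2 u, H u & aff_act u (clamp x) = clamp y.
Proof.
split=> [/(@eqmodP _ slab_equiv)/asboolP//|xy].
by apply/(@eqmodP _ slab_equiv)/asboolP.
Qed.

Lemma slab_prP x y : slab x -> slab y ->
  slab_pr x = slab_pr y <-> exists2 u, H u & aff_act u x = y.
Proof. by move=> sx sy; rewrite slab_prE !clamp_id. Qed.

Lemma slab_pr_clamp x : slab_pr (clamp x) = slab_pr x.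
Proof.
apply/slab_prE; exists (aff_id R m.+1); first exact: slab_id.
by rewrite aff_act_id clamp_id//; exact: clamp_slab.
Qed.

Lemma slab_pr_act u x : H u -> slab x -> slab_pr (aff_act u x) = slab_pr x.
Proof.
by move=> Hu sx; apply/esym/slab_prP => //; [exact: slab_act|exists u].
Qed.

(** A representative with [s = 2] is moved to [s = 0] by the flip. Charts may therefore stay below
    [s = 2]. *)
Lemma slab_pr_surj (q : M) :
  exists x, [/\ slab x, x 0 ord_max < 2 & slab_pr x = q].
Proof.
pose x0 := clamp (repr (q : quotient_topology {eq_quot slab_equiv}%qT)).
have prx0 : slab_pr x0 = q by rewrite slab_pr_clamp; exact: reprK.
have sx0 : slab x0 by exact: clamp_slab.
have [x02|x02] := ltP (x0 0 ord_max) 2; first by exists x0.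
have [u Hu uE] := slab_flip HG.
exists (aff_act u x0); split; first exact: slab_act.
  by rewrite uE ltrBlDr ltrDl (lt_le_trans _ x02).
by rewrite slab_pr_act.
Qed.

Lemma slab_pr_continuous : continuous slab_pr.
Proof. exact: pi_continuous. Qed.

(** In the quotient topology it suffices that the preimage of the image is open. That preimage is
    the union over [H] of the preimages of [W] under the continuous maps [aff_act u \o clamp]. *)
Lemma slab_pr_open W : open W -> open (slab_pr @` (W `&` slab)).
Proof.
move=> oW.
change (open (slab_pr @^-1` (slab_pr @` (W `&` slab)))).
have -> : slab_pr @^-1` (slab_pr @` (W `&` slab)) =
    \bigcup_(u in H) (clamp @^-1` (aff_act u @^-1` W)).
  apply/seteqP; split=> x.
    move=> [w [Ww sw] /esym/slab_prE[u Hu uE]]; exists u => //.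
    by rewrite /preimage /= uE clamp_id.
  move=> [u Hu /= Wu]; exists (aff_act u (clamp x)).
    by split => //; apply: slab_act => //; exact: clamp_slab.
  by rewrite slab_pr_act ?slab_pr_clamp//; exact: clamp_slab.
apply: bigcup_open => u _; apply: open_comp => [x _|].
  exact: clamp_continuous.
by apply: open_comp => // x _; exact: aff_act_continuous.
Qed.

(** * Proper discontinuity and the charts of the quotient *)

Lemma slab_proper x y : exists U V, [/\ open_nbhs x U, open_nbhs y V &
  forall u z, H u -> U z -> V (aff_act u z) -> aff_act u x = y].
Proof.
have [r r0 rP] := slab_discrete HG x y.
(* Elements of [H] stretch sup distances at most [m + 1] times, so [u] moves [U] within [r / 2] of
   the image of [x]. If moreover [u] carries a point of [U] into [V], then the image of [x] is
   within [r] of [y]. *)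
exists (ball x (r / 2 / m.+1%:R)), (ball y (r / 2)).
have r2 : 0 < r / 2 / m.+1%:R by rewrite !divr_gt0.
split; try (split; [exact: ball_open|by apply: ballxx; rewrite // divr_gt0]).
move=> u z Hu xz yuz; apply: rP => //.
rewrite [r]splitr; apply: ball_triangle yuz _.
move: xz; rewrite -!ball_normE /= => xz.
apply: le_lt_trans (aff_act_dist _ _ (slab_isometry HG Hu)) _.
by rewrite mulrC -ltr_pdivlMr// distrC.
Qed.

(** A chart is an open set on which the action identifies no two distinct points. It may extend
    below [s = 0]; since it stays below [s = 2], its part in the half-space lies in the slab. *)
Record slab_chart := SlabChart {
  slab_chart_set :> set E;
  slab_chart_open : open slab_chart_set;
  slab_chart_lt2 : forall x, slab_chart_set x -> x 0 ord_max < 2;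
  slab_chart_sep : forall u x, H u -> slab_chart_set x ->
    slab_chart_set (aff_act u x) -> u = aff_id R m.+1 }.
Implicit Types (c d : slab_chart).

Definition slab_dom c : set M := slab_pr @` (c `&` slab).

(** The local inverse of [slab_pr]; the default value 0 is taken only outside [slab_dom c]. *)
Definition slab_phi c (q : M) : E :=
  xget 0 [set x | [/\ (c : set E) x, slab x & slab_pr x = q]].

Lemma slab_phiP c q : slab_dom c q ->
  [/\ (c : set E) (slab_phi c q), slab (slab_phi c q) &
      slab_pr (slab_phi c q) = q].
Proof.
move=> [x [cx sx] xq]; rewrite /slab_phi; case: xgetP => [y _ //|].
by move=> /(_ x)[]; split.
Qed.

Lemma slab_pr_dom c x : (c : set E) x -> slab x -> slab_dom c (slab_pr x).
Proof. by move=> cx sx; exists x. Qed.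

Lemma slab_phi_pr c x : (c : set E) x -> slab x -> slab_phi c (slab_pr x) = x.
Proof.
move=> cx sx; have [cy sy yx] := slab_phiP (slab_pr_dom cx sx).
have [u Hu uy] := (slab_prP sy sx).1 yx.
have u1 : u = aff_id R m.+1.
  by apply: (slab_chart_sep Hu cy); rewrite uy.
by rewrite -[RHS]uy u1 aff_act_id.
Qed.

Lemma slab_chart_half c x : (c : set E) x -> half_space x -> slab x.
Proof. by move=> /slab_chart_lt2/ltW x2 x0; apply/andP. Qed.

Lemma slab_hausdorff : hausdorff_space M.
Proof.
rewrite open_hausdorff => p q pq.
have [x [sx _ xp]] := slab_pr_surj p; have [y [sy _ yq]] := slab_pr_surj q.
have [U [V [[oU Ux] [oV Vy] UV]]] := slab_proper x y.
exists (slab_pr @` (U `&` slab), slab_pr @` (V `&` slab)).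
  by split; apply/mem_set; [exists x|exists y].
split => /=; [exact: slab_pr_open|exact: slab_pr_open|].
(* A common point of the two images yields an element of [H] carrying a point of [U] into [V], hence
   [x] to [y], so that [p = q]. *)
apply/eqP/seteqP; split => // _ [[z [Uz sz] <-] [w [Vw sw]]].
move=> /esym /(slab_prP sz sw)[u Hu uz]; move/eqP: pq; apply.
rewrite -xp -yq; apply/slab_prP => //; exists u => //.
by apply: UV Hu Uz _; rewrite uz.
Qed.

Lemma slab_second_countable : @second_countable M.
Proof.
have [B Bc [Bo Bb]] := @rV_second_countable R m.+1.
exists ((fun U => slab_pr @` (U `&` slab)) @` B).
  exact: (sub_countable (card_image_le _ _)).
split=> [_ [U BU <-]|q A]; first by apply: slab_pr_open; exact: Bo.
rewrite nbhsE => -[A' [oA' A'q] A'A].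
have [x [sx _ xq]] := slab_pr_surj q.
have [|U [BU Ux] UA] := Bb x (slab_pr @^-1` A').
  by apply: slab_pr_continuous; apply: open_nbhs_nbhs; rewrite xq.
exists (slab_pr @` (U `&` slab)).
  by split; [exists U|exists x].
by move=> _ [y [Uy sy] <-]; apply: A'A; exact: UA.
Qed.

Lemma slab_dom_open c : open (slab_dom c).
Proof. by apply: slab_pr_open; exact: slab_chart_open. Qed.

(** By [slab_proper] at the pair [x], [x], an element that carries a point of a small neighbourhood
    back into it fixes [x], and is trivial because the action is free. *)
Lemma slab_chart_at x : x 0 ord_max < 2 -> exists c, (c : set E) x.
Proof.
move=> x2; have [U [V [[oU Ux] [oV Vx] UV]]] := slab_proper x x.
have oW : open (U `&` V `&` [set y : E | y 0 ord_max < 2]).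
  apply: openI; first exact: openI.
  apply: (@open_comp _ _ (fun y : E => y 0 ord_max) [set t | t < 2]).
    by move=> y _; exact: last_continuous.
  exact: open_lt.
have W2 y : (U `&` V `&` [set y : E | y 0 ord_max < 2]) y -> y 0 ord_max < 2.
  by case.
have Ws u y : H u -> (U `&` V `&` [set y : E | y 0 ord_max < 2]) y ->
    (U `&` V `&` [set y : E | y 0 ord_max < 2]) (aff_act u y) ->
    u = aff_id R m.+1.
  move=> Hu [[Uy _] _] [[_ Vy] _]; apply: (slab_free HG Hu (x := x)).
  exact: UV Hu Uy Vy.
by exists (SlabChart oW W2 Ws).
Qed.

Lemma slab_dom_cover q : exists c, slab_dom c q.
Proof.
have [x [sx x2 <-]] := slab_pr_surj q; have [c cx] := slab_chart_at x2.
by exists c; exact: slab_pr_dom.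
Qed.

Lemma slab_phi_continuous c q :
  slab_dom c q -> {for q, continuous (slab_phi c)}.
Proof.
move=> cq A; have [cx sx xq] := slab_phiP cq.
rewrite nbhsE => -[A' [oA' A'x] A'A].
apply: (@filterS _ _ _ (slab_pr @` (A' `&` c `&` slab))).
  by move=> _ [y [[A'y cy] sy] <-]; apply: A'A; rewrite slab_phi_pr.
apply: open_nbhs_nbhs; split; last by exists (slab_phi c q).
by apply: slab_pr_open; apply: openI => //; exact: slab_chart_open.
Qed.

Lemma slab_phi_open c U : open U -> U `<=` slab_dom c ->
  exists2 V, open V & slab_phi c @` U = V `&` @half_space R m.
Proof.
move=> oU Uc; exists ((c : set E) `&` slab_pr @^-1` U).
  apply: openI; first exact: slab_chart_open.
  by apply: open_comp => // x _; exact: slab_pr_continuous.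
apply/seteqP; split=> [_ [q Uq <-]|x [[cx Ux] hx]].
  have [cx /andP[x0 _] xq] := slab_phiP (Uc _ Uq).
  by split => //; split => //; rewrite /preimage /= xq.
exists (slab_pr x) => //; apply: slab_phi_pr => //.
exact: slab_chart_half cx hx.
Qed.

(** The two coordinates of [q] lie in one orbit, and the element [u] relating them relates the
    charts on a whole neighbourhood: transition maps are locally restrictions of elements of [H]. *)
Lemma slab_transition c d q : slab_dom c q -> slab_dom d q -> exists u, [/\ H u,
  aff_act u (slab_phi c q) = slab_phi d q,
  (aff_act u @^-1` d) (slab_phi c q), open ((c : set E) `&` aff_act u @^-1` d) &
  forall z, ((c : set E) `&` aff_act u @^-1` d) z -> half_space z ->
    slab_phi d (slab_pr z) = aff_act u z].
Proof.
move=> cq dq; have [cx sx xq] := slab_phiP cq; have [dy sy yq] := slab_phiP dq.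
have [|u Hu uE] := (slab_prP sx sy).1; first by rewrite xq yq.
exists u; split => //; first by rewrite /preimage /= uE.
  apply: openI; first exact: slab_chart_open.
  apply: open_comp; last exact: slab_chart_open.
  by move=> y _; exact: aff_act_continuous.
move=> z [cz dz] hz; have sz := slab_chart_half cz hz.
by rewrite -(slab_pr_act Hu sz) slab_phi_pr//; exact: slab_act.
Qed.

Lemma slab_transition_smooth c d :
  smooth_map_within (slab_phi c @` (slab_dom c `&` slab_dom d))
    (slab_phi d \o slab_pr).
Proof.
move=> j _ [q [cq dq] <-].
have [u [Hu uE du oW uP]] := slab_transition cq dq.
exists ((c : set E) `&` aff_act u @^-1` d), (fun z => aff_act u z 0 j).
split => //.
- by split => //; have [] := slab_phiP cq.
- by apply: (@smooth_map_on_affine _ _ _ _ _ u.1 u.2).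
move=> z Wz [p [cp _] pz]; rewrite /= uP//.
by have [_ /andP[+ _] _] := slab_phiP cp; rewrite pz.
Qed.

Lemma slab_transition_jacobian c d q : slab_dom c q -> slab_dom d q ->
  exists2 u, H u &
  partial_jacobian (slab_phi d \o slab_pr) (slab_phi c q) = u.1.
Proof.
move=> cq dq; have [u [Hu uE du oW uP]] := slab_transition cq dq.
have [cx sx xq] := slab_phiP cq; exists u => //.
apply/matrixP => i j; rewrite mxE; apply: partial_affine.
set x := slab_phi c q in uE du cx sx xq *.
have Wx : ((c : set E) `&` aff_act u @^-1` d) x by [].
have hx : half_space x by case/andP: sx.
(* For small [h > 0] the displaced point remains in the overlap, and in the half-space because [h]
   is positive; there the transition map is [u]. *)
near=> h.
have h0 : 0 < h by near: h; exact: nbhs_right_gt.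
have Wh : ((c : set E) `&` aff_act u @^-1` d) (x + h *: delta_mx 0 i).
  near: h; apply: cvg_within.
  have : (fun h : R => x + h *: delta_mx 0 i) h @[h --> (0 : R)] --> x.
    rewrite -[X in _ --> X]addr0 -(scale0r (delta_mx 0 i)).
    apply: (@cvgD _ _ _ (nbhs (0 : R))); first exact: cvg_cst.
    exact: scalel_continuous.
  by apply; exact: open_nbhs_nbhs.
rewrite /= !uP//.
  rewrite /aff_act mulmxDl -scalemxAl -rowE addrAC !mxE; congr (_ + _).
by rewrite /half_space /= !mxE addr_ge0// mulr_ge0// ?ler0n// ltW.
Unshelve. all: by end_near. Qed.

Definition slab_manifold : riemannian_manifold R m M.
Proof.
(* The metric is Euclidean in every chart, which is consistent because transition maps have
   orthogonal Jacobians. The construction is transparent, so that the metric computes to a constant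
   in the curvature lemmas. *)
apply: (@RiemannianManifold R m M slab_chart slab_dom slab_phi
  (fun=> slab_pr) (fun _ _ => 1%:M)).
- exact: slab_hausdorff.
- exact: slab_second_countable.
- exact: slab_dom_open.
- exact: slab_dom_cover.
- by move=> c q /slab_phiP[].
- exact: slab_phi_continuous.
- exact: slab_phi_open.
- exact: slab_transition_smooth.
- by move=> *; rewrite trmx1.
- move=> c q v _ v0; rewrite mulmx1 mxE.
  have [j vj] : exists j, v 0 j != 0 by apply/rV0Pn.
  rewrite (bigD1 j)//= mxE ltr_pwDl//.
    by rewrite -expr2 exprn_even_gt0.
  by rewrite sumr_ge0// => i _; rewrite mxE -expr2 sqr_ge0.
- move=> c a b x _; exists setT, (fun=> (1%:M : 'M[R]_m.+1) a b).
  split => //; first exact: openT.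
  apply: (@smooth_on_affine _ _ _ _ 0 ((1%:M : 'M[R]_m.+1) a b)).
    exact: openT.
  by move=> y _; rewrite mulmx0 [X in _ = X + _]mxE add0r.
move=> c d q cq dq /=; have [u Hu ->] := slab_transition_jacobian cq dq.
by rewrite mulmx1 (slab_isometry HG).
Defined.

Lemma slab_compact : compact [set: M].
Proof.
have [K cK KP] := slab_cocompact HG.
have -> : [set: M] = slab_pr @` K.
  apply/seteqP; split => // q _; have [x [sx _ <-]] := slab_pr_surj q.
  by have [u Hu Ku] := KP _ sx; exists (aff_act u x) => //; rewrite slab_pr_act.
apply: continuous_compact => //; apply: continuous_subspaceT.
exact: slab_pr_continuous.
Qed.

Lemma slab_connected : connected [set: M].
Proof.
have -> : [set: M] = slab_pr @` setT.
  apply/seteqP; split => // q _.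
  by have [x [_ _ <-]] := slab_pr_surj q; exists x.
apply: connected_continuous_connected; first exact: rV_connected.
by apply: continuous_subspaceT; exact: slab_pr_continuous.
Qed.

Lemma slab_flat : flat slab_manifold.
Proof. by move=> c q i j a b _; exact: riemann_curvature_cst. Qed.

Lemma slab_totally_geodesic : totally_geodesic_boundary slab_manifold.
Proof.
move=> c q a b _ _ _ _; rewrite /second_fundamental_form.
by rewrite christoffel_cst mul0r.
Qed.

(** The vanishing of [s] does not depend on the chart: an element of [H] either keeps [s = 0] or
    sends it to [s = 2], a value that no chart attains. *)
Lemma slab_boundaryP c q : boundary slab_manifold q -> slab_dom c q ->
  slab_phi c q 0 ord_max = 0.
Proof.
move=> [/= d dq d0] cq; have [cx sx xq] := slab_phiP cq.
have [dy sy yq] := slab_phiP dq.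
have [|u Hu uE] := (slab_prP sy sx).1; first by rewrite yq xq.
have := slab_chart_lt2 cx.
by have [E|E] := slab_last HG Hu; rewrite -uE E d0// subr0 ltxx.
Qed.

End SlabQuotient.

(** * The boundary of the quotient *)

Section Face.
Variables (R : realType) (m : nat).

(** The inclusion of R^m in R^(m+1) as the hyperplane where the last coordinate
    vanishes; its transpose is the orthogonal projection. *)
Definition face_mx : 'M[R]_(m, m.+1) :=
  \matrix_(i, j) (lift ord_max i == j)%:R.

Lemma mul_face_tr (n : nat) (x : 'M[R]_(n, m.+1)) k i :
  (x *m face_mx^T) k i = x k (lift ord_max i).
Proof.
rewrite mxE (bigD1 (lift ord_max i))//= !mxE eqxx mulr1 big1 ?addr0// => j ji.
by rewrite !mxE eq_sym (negbTE ji) mulr0.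
Qed.

Lemma face_mxK : face_mx *m face_mx^T = 1%:M.
Proof.
by apply/matrixP => i j; rewrite mul_face_tr !mxE (inj_eq lift_inj).
Qed.

Lemma mul_face_last (n : nat) (y : 'M[R]_(n, m)) k :
  (y *m face_mx) k ord_max = 0.
Proof.
rewrite mxE big1// => i _.
by rewrite mxE eq_sym (negbTE (neq_lift _ _)) mulr0.
Qed.

Lemma delta_face_tr : delta_mx 0 ord_max *m face_mx^T = 0 :> 'rV[R]_m.
Proof.
apply/rowP => i; rewrite mul_face_tr !mxE /= eq_sym.
by rewrite (negbTE (neq_lift _ _)).
Qed.

Lemma face_decomp (x : 'rV[R]_m.+1) :
  x *m face_mx^T *m face_mx + x 0 ord_max *: delta_mx 0 ord_max = x.
Proof.
apply/rowP => j; rewrite !mxE /=; case: (unliftP ord_max j) => [i ->|->].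
  rewrite eq_sym (negbTE (neq_lift _ _)) mulr0 addr0 (bigD1 i)//= big1.
    by rewrite mul_face_tr mxE eqxx mulr1 addr0.
  by move=> l li; rewrite [X in _ * X]mxE (inj_eq lift_inj) (negbTE li) mulr0.
rewrite eqxx mulr1 big1 ?add0r// => i _.
by rewrite [X in _ * X]mxE eq_sym (negbTE (neq_lift _ _)) mulr0.
Qed.

Lemma face_decomp0 (x : 'rV[R]_m.+1) :
  x 0 ord_max = 0 -> x *m face_mx^T *m face_mx = x.
Proof. by move=> x0; have := face_decomp x; rewrite x0 scale0r addr0. Qed.

End Face.

Section BoundaryIsometry.
Variables (R : realType) (m : nat) (G : set ('M[R]_m * 'rV[R]_m)).
Variable H : set ('M[R]_m.+1 * 'rV[R]_m.+1).
Hypotheses (GG : bieberbach_group G) (HG : slab_group H).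
Local Notation E := (face_mx R m).
Hypothesis G_face : forall g, G g -> exists2 u, H u & forall y,
  aff_act u (y *m E) = aff_act g y *m E.
Hypothesis face_G : forall u y y', H u -> aff_act u (y *m E) = y' *m E ->
  exists2 g, G g & aff_act g y = y'.

Lemma face_slab (y : 'rV[R]_m) : slab (y *m E).
Proof. by rewrite /slab /= mul_face_last lexx ler0n. Qed.

Definition face_pr (y : 'rV[R]_m) : slab_quotient HG := slab_pr HG (y *m E).

(** By [G_face] and [face_G], an orbit of [H] meets the hyperplane [s = 0] in an orbit of [G] or not
    at all. *)
Lemma face_prP y y' :
  face_pr y = face_pr y' <-> exists2 g, G g & aff_act g y = y'.
Proof.
split=> [/(slab_prP _ (face_slab _) (face_slab _))[u Hu /face_G]|[g Gg <-]].
  exact.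
have [u Hu uE] := G_face Gg.
by rewrite /face_pr -uE slab_pr_act//; exact: face_slab.
Qed.

(** An orbit is a bare set, so a representative is chosen; by [face_prP] the choice is
    immaterial. *)
Definition face_map (o : orbit_space G) : slab_quotient HG :=
  face_pr (projT1 (cid (proj2_sig o))).

Lemma face_map_proj y : face_map (@orbit_proj R m G y) = face_pr y.
Proof.
rewrite /face_map; case: cid => /= x yx; apply/esym/face_prP.
have : orbit_of G x x.
  by exists (aff_id R m); [exact: bieb_id|rewrite aff_act_id].
by rewrite -yx => -[g Gg gx]; exists g.
Qed.

Lemma orbit_of_act g y : G g -> orbit_of G (aff_act g y) = orbit_of G y.
Proof.
move=> Gg; apply/seteqP; split=> _ [h Gh <-].
  by exists (aff_mul h g); [exact: bieb_mul|rewrite aff_actM].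
have [v Gv vg] := bieb_inv GG Gg.
exists (aff_mul h v); first exact: bieb_mul.
by rewrite aff_actM -(aff_actM v g) vg aff_act_id.
Qed.

Lemma orbit_proj_surj (o : orbit_space G) : exists y, o = orbit_proj G y.
Proof.
case: o => A [y Ay]; exists y; rewrite /orbit_proj.
by subst A; congr exist; exact: Prop_irrelevance.
Qed.

Lemma face_map_inj : injective face_map.
Proof.
move=> o o'; have [y ->] := orbit_proj_surj o.
have [y' ->] := orbit_proj_surj o'.
rewrite !face_map_proj => /face_prP[g Gg <-].
(* The proof component is generalized so that the orbit occurring in its type can be rewritten. *)
rewrite /orbit_proj; move: (ex_intro _ (aff_act g y) _).
rewrite orbit_of_act// => e; congr exist; exact: Prop_irrelevance.
Qed.

Lemma face_map_comp : face_map \o @orbit_proj R m G = face_pr.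
Proof. by apply/funext => y; exact: face_map_proj. Qed.

Lemma face_boundary y : boundary (slab_manifold HG) (face_pr y).
Proof.
have [|c cy] := @slab_chart_at _ _ _ HG (y *m E).
  by rewrite mul_face_last.
exists c => /=; first exact: slab_pr_dom (face_slab y).
by rewrite slab_phi_pr ?mul_face_last//; exact: face_slab.
Qed.

Lemma face_map_range : range face_map = boundary (slab_manifold HG).
Proof.
apply/seteqP; split=> [_ [w _ <-]|q bq].
  have [y ->] := orbit_proj_surj w; rewrite face_map_proj.
  exact: face_boundary.
have [c cq] := slab_dom_cover q.
have [cx sx xq] := slab_phiP cq; have x0 := slab_boundaryP bq cq.
exists (orbit_proj G (slab_phi c q *m E^T)) => //.
by rewrite face_map_proj /face_pr face_decomp0.
Qed.

(** Read in a chart, the inclusion of the face is locally an element of [H] restricted to the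
    hyperplane [s = 0]. *)
Lemma face_pr_local c y : slab_dom c (face_pr y) -> exists u, [/\ H u,
  aff_act u (y *m E) = slab_phi c (face_pr y),
  forall z, aff_act u z 0 ord_max = z 0 ord_max,
  open [set y' | (c : set _) (aff_act u (y' *m E))] &
  forall y', (c : set _) (aff_act u (y' *m E)) ->
    slab_dom c (face_pr y') /\ slab_phi c (face_pr y') = aff_act u (y' *m E)].
Proof.
move=> cq; have [cx sx xq] := slab_phiP cq.
have x0 := slab_boundaryP (face_boundary y) cq.
have [|u Hu uE] := (slab_prP HG (face_slab y) sx).1; first by rewrite xq.
exists u; split => //.
(* A flip would send [s = 0] to [s = 2], but the image has [s = 0]. *)
- have [// | uE'] := slab_last HG Hu.
  have := uE' (y *m face_mx R m).
  rewrite uE x0 mul_face_last subr0 => /esym/eqP.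
  by rewrite pnatr_eq0.
- apply: (@open_comp _ _ (fun y' : 'rV[R]_m => aff_act u (y' *m E)) c).
    2: exact: slab_chart_open.
  move=> y' _.
  apply: (@continuous_comp _ _ _ (fun y' : 'rV[R]_m => y' *m E) (aff_act u)).
    exact: mulmxr_continuous.
  exact: aff_act_continuous.
move=> y' cy'; have sy' := slab_act HG Hu (face_slab y').
have <- : slab_pr HG (aff_act u (y' *m E)) = face_pr y'.
  by rewrite slab_pr_act//; exact: face_slab.
by split; [exact: slab_pr_dom|rewrite slab_phi_pr].
Qed.

(** In a chart the map is affine with linear part [E *m u.1], whose rows are orthonormal since
    [E *m E^T = 1] and [u.1] is orthogonal. The inverse of [u] followed by the projection [E^T] is a
    smooth local inverse. *)
Lemma face_map_isometry : boundary_isometry (slab_manifold HG) face_map.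
Proof.
rewrite /boundary_isometry face_map_comp; split.
- exact: face_map_inj.
- exact: face_map_range.
- move=> c y cq /=; have [u [Hu uE ul oV uP]] := face_pr_local cq.
  exists [set y' | (c : set _) (aff_act u (y' *m E))]; split => //.
  + by rewrite /= uE; have [] := slab_phiP cq.
  + by move=> _ [y' cy' <-]; have [] := uP _ cy'.
  apply: (@smooth_map_on_affine _ _ _ _ _ (E *m u.1) u.2) => // y' cy'.
  by rewrite /= (uP _ cy').2 /aff_act mulmxA.
- move=> c y cq /=; have [u [Hu uE ul oV uP]] := face_pr_local cq.
  rewrite (@jacobian_affine _ _ _ [set y' | (c : set _) (aff_act u (y' *m E))]
    _ (E *m u.1) u.2)//.
  + rewrite mulmx1 trmx_mul -mulmxA (mulmxA u.1) (slab_isometry HG Hu).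
    by rewrite mul1mx face_mxK.
  + by rewrite /= uE; have [] := slab_phiP cq.
  by move=> y' cy'; rewrite /= (uP _ cy').2 /aff_act mulmxA.
move=> c y cq /=; have [u [Hu uE ul oV uP]] := face_pr_local cq.
have [v Hv vu] := slab_inv HG Hu.
exists setT, (fun z => aff_act v z *m E^T); split => //.
- exact: openT.
- apply: (@smooth_map_on_affine _ _ _ _ _ (v.1 *m E^T) (v.2 *m E^T)).
    exact: openT.
  by move=> z _; rewrite /aff_act mulmxDl mulmxA.
- by rewrite -uE -aff_actM vu aff_act_id -mulmxA face_mxK mulmx1.
move=> q dq bq _; have [cz sz zq] := slab_phiP dq.
have z0 := slab_boundaryP bq dq.
(* Like [u], its inverse is not a flip; hence it sends boundary coordinates into the hyperplane,
   where projecting loses nothing. *)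
have vl : forall z, aff_act v z 0 ord_max = z 0 ord_max.
  have [// | uE'] := slab_last HG Hv.
  have := uE' (aff_act u (y *m face_mx R m)).
  rewrite -aff_actM vu aff_act_id ul mul_face_last subr0 => /esym/eqP.
  by rewrite pnatr_eq0.
rewrite /face_pr face_decomp0 ?vl// slab_pr_act//.
Qed.

Lemma slab_group_bounds : bounds_compact_flat_manifold G.
Proof.
exists (slab_quotient HG), (slab_manifold HG); split.
- exact: slab_compact.
- exact: slab_connected.
- exact: slab_flat.
- exact: slab_totally_geodesic.
by exists face_map; exact: face_map_isometry.
Qed.

End BoundaryIsometry.

(** * Discreteness of Bieberbach groups *)

Lemma aff_mulA (R : realType) (n : nat) (u v w : 'M[R]_n * 'rV[R]_n) :
  aff_mul u (aff_mul v w) = aff_mul (aff_mul u v) w.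
Proof. by rewrite /aff_mul /= mulmxDl !mulmxA addrA. Qed.

Lemma aff_mul1 (R : realType) (n : nat) (u : 'M[R]_n * 'rV[R]_n) :
  aff_mul u (aff_id R n) = u.
Proof. by case: u => A a; rewrite /aff_mul /= mul1mx mul0mx add0r. Qed.

Lemma aff_1mul (R : realType) (n : nat) (u : 'M[R]_n * 'rV[R]_n) :
  aff_mul (aff_id R n) u = u.
Proof. by case: u => A a; rewrite /aff_mul /= !mulmx1 addr0. Qed.

Lemma aff_act_inj (R : realType) (n : nat) (u v : 'M[R]_n * 'rV[R]_n) :
  aff_act u =1 aff_act v -> u = v.
Proof.
case: u v => [A a] [B b] uv.
have ab : a = b by have := uv 0; rewrite /aff_act !mul0mx !add0r.
rewrite ab; congr pair; apply/row_matrixP => i; rewrite !rowE.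
by have := uv (delta_mx 0 i); rewrite /aff_act ab => /addIr.
Qed.

(** By compactness, finitely many balls of radius [e / 2] cover a closed ball containing [D], and
    each of them contains at most one point of [D]. *)
Lemma bounded_separated_finite (R : realType) (n : nat) (D : set 'rV[R]_n)
    (B e : R) : 0 < e -> (forall x, D x -> `|x| <= B) ->
  (forall x y, D x -> D y -> `|x - y| < e -> x = y) -> finite_set D.
Proof.
move=> e0 DB De.
pose C : set 'rV[R]_n := closed_ball_ (fun x => `|x|) 0 B.
have Cc : compact C.
  apply: bounded_closed_compact; last exact: closed_closed_ball_.
  exists B; split; first exact: num_real.
  move=> M BM x; rewrite /C /closed_ball_ /= sub0r normrN => xB.
  exact: le_trans xB (ltW BM).
move: Cc; rewrite compact_cover => /(_ 'rV[R]_n setT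
  (fun x : 'rV[R]_n => ball x (e / 2))).
case=> [x _|x _|S _ CS].
- by apply: ball_open; rewrite divr_gt0.
- by exists x => //; apply: ballxx; rewrite divr_gt0.
have DS : D `<=` \bigcup_(c in [set` S]) (D `&` ball c (e / 2)).
  move=> x Dx; have [|c Sc cx] := CS x; last by exists c.
  by rewrite /C /closed_ball_ /= sub0r normrN DB.
apply: sub_finite_set DS _.
apply: bigcup_finite => // c _.
have [->|/set0P[x [Dx cx]]] := eqVneq (D `&` ball c (e / 2)) set0.
  exact: finite_set0.
apply: (@sub_finite_set _ _ [set x]); last exact: finite_set1.
move=> y [Dy cy]; apply: De => //.
have : ball x (e / 2 + e / 2) y by apply: ball_triangle cy; apply: ball_sym.
by rewrite -splitr -ball_normE /= distrC.
Qed.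

Section Discrete.
Variables (R : realType) (m : nat) (G : set ('M[R]_m * 'rV[R]_m)).
Hypothesis GG : bieberbach_group G.
Implicit Types (g h : 'M[R]_m * 'rV[R]_m) (x y : 'rV[R]_m).

(** The identity is isolated, and composing with the inverse of [h] turns a pair [g], [h] of close
    elements into an element close to the identity. Orthogonality makes the loss of distance
    uniform. *)
Lemma bieb_unif : exists2 e : R, 0 < e & forall g h, G g -> G h ->
  `|g.1 - h.1| < e -> `|g.2 - h.2| < e -> g = h.
Proof.
have [_ [V V1 VG]] : isolated G (aff_id R m).
  by rewrite (bieb_discrete GG); exact: bieb_id.
have [d /= d0 dV] := (nbhs_ballP _ _).1 V1.
(* Multiplication by [v.1] enlarges norms at most [m] times; [m + 1] also avoids a division by
   zero. *)
exists (d / m.+1%:R); first by rewrite divr_gt0.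
move=> g h Gg Gh gh1 gh2.
have [v Gv vh] := bieb_inv GG Gh.
have vU := bieb_isometry GG Gv.
have small p (C : 'M[R]_(p, m)) : `|C| < d / m.+1%:R -> `|C *m v.1| < d.
  move=> Cd; apply: le_lt_trans (mulmx_norm_le _ _) _.
  apply: le_lt_trans (_ : m.+1%:R * `|C| < d).
    rewrite -mulrA ler_pM ?mulr_ge0// ?ler_nat//.
    by rewrite ler_piMr// unitary_norm_le1.
  by rewrite mulrC -ltr_pdivlMr.
have [vh1 vh2] : h.1 *m v.1 = 1%:M /\ h.2 *m v.1 + v.2 = 0 by case: vh.
have vg : aff_mul v g = aff_id R m.
  suff : (V `&` G) (aff_mul v g) by rewrite VG.
  split; last exact: bieb_mul.
  apply: dV; split; rewrite /= -ball_normE /= -normrN opprB.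
    by rewrite -vh1 -mulmxBl; exact: small.
  by rewrite -vh2 opprD addrACA subrr addr0 -mulmxBl; exact: small.
have cancel p (C D : 'M[R]_(p, m)) : C *m v.1 = D *m v.1 -> C = D.
  move=> /(congr1 (mulmx^~ v.1^T)).
  by rewrite -!mulmxA vU !mulmx1.
have [gv1 gv2] : g.1 *m v.1 = 1%:M /\ g.2 *m v.1 + v.2 = 0 by case: vg.
rewrite (surjective_pairing g) (surjective_pairing h); congr pair.
  by apply: cancel; rewrite gv1 vh1.
by apply: cancel; apply: (addIr v.2); rewrite gv2 vh2.
Qed.

(** Linear parts are orthogonal, hence bounded. Laying each pair out as one row vector by [P] gives
    a bounded set, separated by [bieb_unif]. *)
Lemma bieb_finite (B : R) : finite_set [set g | G g /\ `|g.2| <= B].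
Proof.
have [e e0 eP] := bieb_unif.
pose P g := row_mx (mxvec g.1) g.2.
have PB g h : P g - P h = row_mx (mxvec (g.1 - h.1)) (g.2 - h.2).
  by rewrite /P opp_row_mx add_row_mx linearB.
have PE1 g h i j : `|(g.1 - h.1) i j| <= `|P g - P h|.
  apply: le_trans (mx_entry_le _ 0 (lshift _ (mxvec_index i j))).
  by rewrite PB row_mxEl mxvecE.
have PE2 g h i j : `|(g.2 - h.2) i j| <= `|P g - P h|.
  apply: le_trans (mx_entry_le _ 0 (rshift _ j)).
  by rewrite PB row_mxEr ord1.
have Pinj g h : G g -> G h -> `|P g - P h| < e -> g = h.
  move=> Gg Gh gh; apply: eP => //; apply: le_lt_trans gh.
    exact: mx_norm_le.
  exact: mx_norm_le.
have : finite_set (P @` [set g | G g /\ `|g.2| <= B]).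
  apply: (@bounded_separated_finite _ _ _ (1 + `|B|) e) => //.
    move=> _ [g [Gg gB] <-]; apply: mx_norm_le => [|i j].
      by rewrite addr_ge0.
    rewrite ord1 -(splitK j); case: (fintype.split j) => l /=.
      rewrite row_mxEl; case/mxvec_indexP: l => a b; rewrite mxvecE.
      apply: (le_trans (mx_entry_le _ _ _)).
      by rewrite (le_trans (unitary_norm_le1 (bieb_isometry GG Gg)))// lerDl.
    rewrite row_mxEr; apply: (le_trans (mx_entry_le _ _ _)).
    by rewrite (le_trans gB)// (le_trans (ler_norm _))// lerDr.
  move=> _ _ [g [Gg _] <-] [h [Gh _] <-] gh.
  by rewrite (Pinj g h).
rewrite (@eq_finite_set _ _ _ [set g | G g /\ `|g.2| <= B])//.
apply: inj_card_eq => g h /set_mem[Gg _] /set_mem[Gh _] gh.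
by apply: Pinj => //; rewrite gh subrr normr0.
Qed.

(** If [g] moves [x] within 1 of [y], then [g.2] is bounded, so [g] lies in the finite set [S]. The
    points other than [y] to which [S] moves [x] form a finite, hence closed, set avoiding [y]. *)
Lemma bieb_orbit_discrete x y : exists2 r : R, 0 < r & forall g, G g ->
  ball y r (aff_act g x) -> aff_act g x = y.
Proof.
pose S := [set g | G g /\ `|g.2| <= 1 + `|y| + m%:R * `|x|].
pose T := ((fun g => aff_act g x) @` S) `\ y.
have Tc : closed T.
  have [+ _] := @accessible_finite_set_closed 'rV[R]_m.
  apply; first by apply: hausdorff_accessible; exact: norm_hausdorff.
  apply: (@sub_finite_set _ _ ((fun g => aff_act g x) @` S)).
    by move=> ? [].
  by apply: finite_image; exact: bieb_finite.
have /nbhs_ballP[r /= r0 rT] : nbhs y (~` T).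
  by apply: open_nbhs_nbhs; split; [exact: closed_openC|case=> _; apply].
exists (Num.min r 1); first by rewrite lt_min r0 ltr01.
move=> g Gg; rewrite -ball_normE /= lt_min => /andP[gr g1].
apply: contrapT => gy; apply: (rT (aff_act g x)); first by rewrite -ball_normE.
split => //; exists g => //; split => //.
have -> : g.2 = y - (y - aff_act g x) - x *m g.1.
  by rewrite subKr /aff_act addrAC subrr add0r.
apply: (le_trans (ler_normB _ _)); apply: lerD.
  by apply: (le_trans (ler_normB _ _)); rewrite addrC lerD// ltW.
apply: (le_trans (mulmx_norm_le _ _)).
by rewrite ler_piMr ?mulr_ge0// unitary_norm_le1//; exact: (bieb_isometry GG).
Qed.
End Discrete.

(** * Holonomy and invariant translations *)

Definition aff_pow (R : realType) (n : nat) (u : 'M[R]_n * 'rV[R]_n)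
    (j : nat) :=
  iter j (aff_mul u) (aff_id R n).

Section Holonomy.
Variables (R : realType) (m : nat) (G : set ('M[R]_m * 'rV[R]_m)).
Hypothesis GG : bieberbach_group G.
Implicit Types (g h u : 'M[R]_m * 'rV[R]_m) (x y v : 'rV[R]_m).

Lemma aff_pow_lin u j : (aff_pow u j).1 = u.1 ^+ j.
Proof. by elim: j => //= j IH; rewrite exprSr -IH. Qed.

Lemma aff_pow_in u j : G u -> G (aff_pow u j).
Proof.
by move=> Gu; elim: j => [|j IH]; [exact: bieb_id|exact: bieb_mul].
Qed.

Lemma aff_pow_act u j x : aff_act (aff_pow u j) x = iter j (aff_act u) x.
Proof. by elim: j => [|j IH] /=; rewrite ?aff_act_id// aff_actM IH. Qed.

Lemma bieb_invr g h : G g -> G h -> aff_mul h g = aff_id R m ->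
  aff_mul g h = aff_id R m.
Proof.
move=> Gg Gh hg; have [k Gk kh] := bieb_inv GG Gh.
rewrite -[LHS]aff_1mul -{1}kh -aff_mulA (aff_mulA h) hg aff_1mul.
exact: kh.
Qed.

(** Elements with the same linear part differ by a translation of [G], and composing with a
    translation does not change the linear part. *)
Lemma translation_coset_eq g h : G g -> G h ->
  (translation_coset G g = translation_coset G h) <-> g.1 = h.1.
Proof.
have sub a b : G a -> G b -> a.1 = b.1 ->
    translation_coset G a `<=` translation_coset G b.
  move=> Ga Gb ab _ [t [Gt t1] <-].
  have [v Gv vb] := bieb_inv GG Gb.
  exists (aff_mul v (aff_mul a t)).
    split; first by do 2![apply: bieb_mul => //].
    have : (aff_mul v b).1 = 1%:M by rewrite vb.
    by rewrite /= t1 mul1mx ab.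
  by rewrite aff_mulA (bieb_invr Gb Gv vb) aff_1mul.
move=> Gg Gh; split=> [gh|gh].
  have : translation_coset G g g.
    exists (aff_id R m); last by rewrite aff_mul1.
    by split => //; exact: bieb_id.
  by rewrite gh => -[t [_ t1] <-] /=; rewrite t1 mul1mx.
by apply/seteqP; split; exact: sub.
Qed.

(** The linear parts form a cyclic group whose order is that of the holonomy
    group, because a translation coset is determined by its linear part. *)
Lemma holonomy_cyclic_lin k : holonomy_cyclic_of_order G k ->
  exists2 u, G u & u.1 ^+ k = 1 /\ forall g, G g -> exists j, g.1 = u.1 ^+ j.
Proof.
move=> [Gk [u Gu uP]]; exists u => //.
pose c j := translation_coset G (aff_pow u j).
have cE i j : c i = c j <-> u.1 ^+ i = u.1 ^+ j.
  by rewrite translation_coset_eq ?aff_pow_lin//; exact: aff_pow_in.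
have hol : holonomy G = range c.
  apply/seteqP; split=> [C /uP[j ->]|_ [j _ <-]]; first by exists j.
  by exists (aff_pow u j) => //; exact: aff_pow_in.
split; last first.
  move=> g Gg; have [|j] := uP (translation_coset G g); first by exists g.
  move=> /translation_coset_eq -> //; last exact: aff_pow_in.
  by exists j; rewrite aff_pow_lin.
have fin : finite_set (range c) by rewrite -hol; apply/finite_setP; exists k.
have unit_u i : u.1 ^+ i *m (u.1 ^+ i)^T = 1%:M.
  rewrite -aff_pow_lin; apply: (bieb_isometry GG); exact: aff_pow_in.
(* There are finitely many cosets, so two powers of [u.1] agree; the smaller one is cancelled by its
   transpose. *)
have n_ex : exists n, (0 < n)%N && (u.1 ^+ n == 1).
  have [i [j [ij cij]]] : exists i j, (i < j)%N /\ c i = c j.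
    apply: contrapT => inj; apply: infinite_nat.
    rewrite -(@eq_finite_set _ _ (range c))//.
    apply: inj_card_eq => i j _ _ cij.
    by case: (ltngtP i j) => // ij; exfalso; apply: inj;
      [exists i, j|exists j, i].
  exists (j - i)%N; rewrite subn_gt0 ij /=.
  move/cE: cij; rewrite -[in RHS](subnK (ltnW ij)) exprD => cij.
  have := congr1 (fun A => A *m (u.1 ^+ i)^T) cij.
  by rewrite -mulmxE -mulmxA unit_u mulmx1 => <-; apply/eqP.
have [n /andP[n0 /eqP un] nmin] := ex_minnP n_ex.
(* The first [n] powers represent each coset exactly once, so the least exponent [n] is the number
   [k] of cosets. *)
suff <- : n = k by [].
apply/card_eq_II; apply: card_eq_trans Gk; rewrite hol.
have -> : range c = c @` `I_n.
  apply/seteqP; split=> _ [j _ <-]; last by exists j.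
  exists (j %% n)%N; first by rewrite /= ltn_mod.
  by apply/cE; rewrite [in RHS](divn_eq j n) exprD mulnC exprM un expr1n mul1r.
apply/card_esym/inj_card_eq => i j /set_mem /= ilt /set_mem /= jlt.
have main a b : (a < b)%N -> (b < n)%N -> c a <> c b.
  move=> ab bn /cE; rewrite -[in RHS](subnK (ltnW ab)) exprD => E.
  have := congr1 (fun A => A *m (u.1 ^+ a)^T) E.
  rewrite -mulmxE -mulmxA unit_u mulmx1 => /esym ub.
  have := nmin (b - a)%N; rewrite subn_gt0 ab ub eqxx /= => /(_ isT).
  by rewrite leqNgt (leq_ltn_trans (leq_subr _ _) bn).
by case: (ltngtP i j) => // ij cij; exfalso;
  [apply: (main i j)|apply: (main j i)].
Qed.

(** * Translations invariant under the holonomy *)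

Lemma bieb_nontrivial : (0 < m)%N -> exists2 g, G g & g <> aff_id R m.
Proof.
move=> m0; apply: contrapT => G1.
have Gid g : G g -> g = aff_id R m.
  by move=> Gg; apply: contrapT => ?; apply: G1; exists g.
have [K Kc KP] := bieb_cocompact GG.
(* Were [G] trivial, the compact set [K] would be the whole space, which is unbounded as [m > 0]. *)
have KT x : K x by have [g /Gid -> ] := KP x; rewrite aff_act_id.
have [M [_ MP]] := compact_bounded Kc.
pose v : 'rV[R]_m := const_mx (`|M| + 2).
have M1 : M < `|M| + 1 by rewrite (le_lt_trans (ler_norm _))// ltrDl.
have /= := MP _ M1 v (KT v); rewrite leNgt => /negP; apply.
apply: lt_le_trans (mx_entry_le v 0 (Ordinal m0)).
by rewrite mxE [ltRHS]ger0_norm ?addr_ge0// ltrD2l ltr1n.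
Qed.

(** An element of finite order fixes the barycenter of any of its orbits. *)
Lemma bieb_torsion_free u k : G u -> (0 < k)%N -> aff_pow u k = aff_id R m ->
  u = aff_id R m.
Proof.
move=> Gu k0 uk; pose p i := iter i (aff_act u) 0.
apply: (bieb_free GG (x := k%:R^-1 *: \sum_(i < k) p i)) => //.
have kR : k%:R != 0 :> R by rewrite pnatr_eq0 -lt0n.
have pk : p k = p 0%N by rewrite /p -aff_pow_act uk aff_act_id.
(* Applying [u] shifts the orbit cyclically, because [p k = p 0]. *)
have shift : \sum_(i < k) p i.+1 = \sum_(i < k) p i.
  apply: (addrI (p 0%N)); rewrite -(big_ord_recl k (fun i => p i)).
  by rewrite big_ord_recr /= pk addrC.
rewrite -[in RHS]shift /aff_act -scalemxAl.
under [in RHS]eq_bigr do rewrite /p iterS /aff_act.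
rewrite big_split /= sumr_const card_ord scalerDr.
rewrite -[u.2 *+ k]scaler_nat scalerA mulVf//.
by rewrite scale1r mulmx_suml.
Qed.

Lemma bieb_invariant_translation k : (0 < m)%N -> (0 < k)%N ->
  holonomy_cyclic_of_order G k ->
  exists v, [/\ v != 0, G (1%:M, v) & forall g, G g -> v *m g.1 = v].
Proof.
move=> m0 k0 /holonomy_cyclic_lin[u Gu [uk uP]].
have Guk := aff_pow_in k Gu.
have uk1 : (aff_pow u k).1 = 1%:M by rewrite aff_pow_lin uk.
pose v := (aff_pow u k).2.
have vE : aff_pow u k = (1%:M, v) by rewrite -uk1 -surjective_pairing.
have vu : v *m u.1 = v.
  (* Comparing the translation parts of both sides gives [v *m u.1 = v]. *)
  have comm : aff_mul u (aff_pow u k) = aff_mul (aff_pow u k) u.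
    by apply: aff_act_inj => x; rewrite !aff_actM !aff_pow_act -iterS -iterSr.
  move: (congr1 snd comm); rewrite vE /= mulmx1 addrC => /addrI //.
have vj j : v *m u.1 ^+ j = v.
  by elim: j => [|j IH]; rewrite ?mulmx1// exprS -mulmxE mulmxA vu.
have [v0|v0] := eqVneq v 0; last first.
  exists v; split => //; first by rewrite -vE.
  by move=> g /uP[j ->].
(* With [u] trivial, all linear parts are 1, so any nontrivial element of [G] is an invariant
   translation. *)
have u1 : u = aff_id R m by apply: (bieb_torsion_free Gu k0); rewrite vE v0.
have [g Gg g1] := bieb_nontrivial m0.
have lin1 h : G h -> h.1 = 1%:M.
  by move=> /uP[j ->]; rewrite u1 /= expr1n.
exists g.2; split.
- apply/eqP => g2; apply: g1.
  by rewrite (surjective_pairing g) (lin1 _ Gg) g2.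
- by rewrite -(lin1 _ Gg) -surjective_pairing.
by move=> h Gh; rewrite lin1// mulmx1.
Qed.

(** Otherwise all successive halves of [v] would be translations in [G], accumulating at the
    identity against [bieb_unif]. *)
Lemma bieb_indivisible_translation v : v != 0 -> G (1%:M, v) ->
  exists j, G (1%:M, 2^-1 ^+ j *: v) /\ ~ G (1%:M, 2^-1 ^+ j.+1 *: v).
Proof.
move=> v0 Gv; apply: contrapT => Gj.
have all_j j : G (1%:M, 2^-1 ^+ j *: v).
  elim: j => [|j IH]; first by rewrite expr0 scale1r.
  by apply: contrapT => Gj1; apply: Gj; exists j.
have [e e0 eP] := bieb_unif GG.
(* This [j] exceeds the norm of [v] divided by [e]; a fortiori so does [2 ^ j], which makes the
   [j]-th half shorter than [e]. *)
have := archi_boundP (divr_ge0 (normr_ge0 v) (ltW e0)).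
set j := Num.bound _ => vj.
suff : (1%:M, 2^-1 ^+ j *: v) = aff_id R m.
  move=> /(congr1 snd) /= /eqP; rewrite scaler_eq0 (negbTE v0) orbF.
  by rewrite expf_eq0 invr_eq0 pnatr_eq0 andbF.
apply: eP => //=; first exact: bieb_id.
  by rewrite subrr normr0.
rewrite subr0 normrZ normrX normfV ger0_norm// exprVn mulrC.
rewrite ltr_pdivrMr ?exprn_gt0// mulrC -ltr_pdivrMr//.
apply: lt_trans vj _.
by rewrite -natrX ltr_nat ltn_expl.
Qed.

Lemma translation_sum v j : G (1%:M, v) -> G (1%:M, v *+ j).
Proof.
move=> Gv; elim: j => [|j IH]; first by rewrite mulr0n; exact: (bieb_id GG).
by have := bieb_mul GG Gv IH; rewrite /aff_mul /= !mulmx1 mulrSr.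
Qed.

Lemma bieb_half_translation k : (0 < m)%N -> odd k ->
  holonomy_cyclic_of_order G k ->
  exists w, [/\ G (1%:M, w + w), forall g, G g -> w *m g.1 = w &
    forall g x, G g -> aff_act g x + w <> x].
Proof.
move=> m0 ok hk; have k0 : (0 < k)%N by case: (k) ok.
have [v [v0 Gv vG]] := bieb_invariant_translation m0 k0 hk.
have [j [Gj Gj1]] := bieb_indivisible_translation v0 Gv.
have [u Gu [uk uP]] := holonomy_cyclic_lin hk.
set w := 2^-1 ^+ j.+1 *: v in Gj1.
have ww : w + w = 2^-1 ^+ j *: v.
  by rewrite /w -scalerDl exprS mulrC -splitr.
have wG g : G g -> w *m g.1 = w by move=> Gg; rewrite -scalemxAl vG.
exists w; split => //; first by rewrite ww.
move=> g x Gg gx; apply: Gj1; rewrite -/w.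
(* The assumption says that [g] moves [x] by [- w]; since [g.1] fixes [w], each further application
   subtracts another [w]. *)
have gxi i : aff_act (aff_pow g i) x = x - w *+ i.
  elim: i => [|i IH]; first by rewrite aff_act_id subr0.
  have nw : (w *+ i) *m g.1 = w *+ i by rewrite -scaler_nat -scalemxAl wG.
  rewrite aff_actM IH /aff_act mulmxBl nw addrAC -[_ + g.2]/(aff_act g x).
  by rewrite mulrS opprD addrA -{2}gx addrK.
have gk1 : (aff_pow g k).1 = 1%:M.
  have [i gi] := uP _ Gg.
  by rewrite aff_pow_lin gi -exprM mulnC exprM uk expr1n.
have gk2 : (aff_pow g k).2 = - (w *+ k).
  have := gxi k; rewrite /aff_act gk1 mulmx1 => /(addrI x) //.
have Gk : G (1%:M, - (w *+ k)).
  by rewrite -gk1 -gk2 -surjective_pairing; exact: aff_pow_in.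
(* As [k] is odd, [2 (k./2 + 1) = k + 1]; adding this translation to [- k w] leaves [w]. *)
have Gww : G (1%:M, (w + w) *+ k./2.+1) by apply: translation_sum; rewrite ww.
have := bieb_mul GG Gk Gww; rewrite /aff_mul /= !mulmx1.
rewrite -mulr2n -mulrnA mul2n doubleS -[in w *+ k](odd_double_half k) ok.
by rewrite add1n [w *+ _.+2]mulrS addrK.
Qed.
End Holonomy.

(** * The group generated by G and the involution *)

Section Double.
Variables (R : realType) (m : nat) (G : set ('M[R]_m * 'rV[R]_m)).
Hypothesis GG : bieberbach_group G.
Variable w : 'rV[R]_m.
Hypothesis Gww : G (1%:M, w + w).
Hypothesis wG : forall g, G g -> w *m g.1 = w.
Hypothesis w_free : forall g x, G g -> aff_act g x + w <> x.
Implicit Types (g h : 'M[R]_m * 'rV[R]_m) (y : 'rV[R]_m) (x : 'rV[R]_m.+1).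
Local Notation E := (face_mx R m).
Local Notation e := (delta_mx 0 ord_max : 'rV[R]_m.+1).

(** The map (y, s) |-> (g y, s) followed, if [b] holds, by
    (y, s) |-> (y + w, 2 - s). *)
Definition double g (b : bool) : 'M[R]_m.+1 * 'rV[R]_m.+1 :=
  (E^T *m g.1 *m E + (-1) ^+ b *: (e^T *m e),
   (g.2 + w *+ b) *m E + 2%:R *+ b *: e).

Definition double_group : set ('M[R]_m.+1 * 'rV[R]_m.+1) :=
  [set u | exists g b, G g /\ u = double g b].

Lemma last_delta x : x *m e^T = (x 0 ord_max)%:M.
Proof.
by rewrite trmx_delta -colE; apply/matrixP => i j; rewrite !ord1 !mxE.
Qed.

Lemma double_act g b x : aff_act (double g b) x =
  (aff_act g (x *m E^T) + w *+ b) *m E +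
  (2%:R *+ b + (-1) ^+ b * x 0 ord_max) *: e.
Proof.
rewrite /aff_act /= mulmxDr -scalemxAr !mulmxA last_delta mul_scalar_mx.
rewrite scalerA scalerDl -[_ + g.2 + _]addrA (mulmxDl _ (g.2 + _)) addrACA.
by congr (_ + _); rewrite addrC.
Qed.

Lemma face_coord y (s : R) : (y *m E + s *: e) *m E^T = y.
Proof.
rewrite mulmxDl -mulmxA face_mxK mulmx1 -scalemxAl delta_face_tr.
by rewrite scaler0 addr0.
Qed.

Lemma last_coord y (s : R) : (y *m E + s *: e) 0 ord_max = s.
Proof. by rewrite mxE mul_face_last add0r !mxE !eqxx mulr1. Qed.

Lemma double_face g b x :
  aff_act (double g b) x *m E^T = aff_act g (x *m E^T) + w *+ b.
Proof. by rewrite double_act face_coord. Qed.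

Lemma double_last g b x : aff_act (double g b) x 0 ord_max =
  if b then 2 - x 0 ord_max else x 0 ord_max.
Proof.
rewrite double_act last_coord; case: b => /=.
  by rewrite mulr1n expr1 mulN1r.
by rewrite mulr0n expr0 mul1r add0r.
Qed.

Lemma face_last_inj x x' :
  x *m E^T = x' *m E^T -> x 0 ord_max = x' 0 ord_max -> x = x'.
Proof.
by move=> xE xl; rewrite -(face_decomp x) -(face_decomp x') xE xl.
Qed.

(** The linear part is block diagonal, with orthogonal blocks [g.1] and a sign. The cross terms
    vanish and [E^T *m E + e^T *m e] remains, the identity by [face_decomp]. *)
Lemma double_isometry u : double_group u -> u.1 *m u.1^T = 1%:M.
Proof.
move=> [g [b [Gg ->]]] /=; have g1 := bieb_isometry GG Gg.
have Ee : E *m e^T = 0.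
  by rewrite -[LHS]trmxK trmx_mul trmxK delta_face_tr trmx0.
have ee : e *m e^T = 1 by rewrite last_delta mxE !eqxx.
rewrite linearD /= !trmx_mul !trmxK linearZ /= trmx_mul trmxK.
rewrite mulmxDl !mulmxDr -!scalemxAr -!scalemxAl.
rewrite !mulmxA -(mulmxA _ E E^T) face_mxK mulmx1.
rewrite -(mulmxA E^T g.1) g1 mulmx1.
rewrite -(mulmxA _ E e^T) Ee mulmx0 mul0mx scaler0 addr0.
rewrite -(mulmxA e^T e E^T) delta_face_tr mulmx0 !mul0mx scaler0 add0r.
rewrite -(mulmxA e^T e e^T) ee mulmx1 scalerA -expr2 sqrr_sign scale1r.
apply/row_matrixP => i; rewrite !rowE mulmx1 mulmxDr !mulmxA.
by rewrite last_delta mul_scalar_mx face_decomp.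
Qed.

Lemma aff_act_addw g y : G g -> aff_act g (y + w) = aff_act g y + w.
Proof. by move=> Gg; rewrite /aff_act mulmxDl wG// addrAC. Qed.

(** The involution commutes with [G], since linear parts fix [w], and its square is the translation
    by [w + w], which lies in [G] and is absorbed into the [G] part when both factors flip. *)
Lemma double_mul u v :
  double_group u -> double_group v -> double_group (aff_mul u v).
Proof.
move=> [g [b [Gg ->]]] [h [c [Gh ->]]].
have [Gt tE] : G (if b && c then (1%:M, w + w) else aff_id R m) /\
    forall y, aff_act (if b && c then (1%:M, w + w) else aff_id R m) y =
      y + (w + w) *+ (b && c).
  case: (b && c); split => //.
  - by move=> y; rewrite /aff_act /= mulmx1.
  - exact: bieb_id.
  - by move=> y; rewrite aff_act_id addr0.
exists (aff_mul (if b && c then (1%:M, w + w) else aff_id R m) (aff_mul g h)).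
exists (b (+) c); split; first by do 2![apply: bieb_mul => //].
apply: aff_act_inj => x; rewrite aff_actM; apply: face_last_inj.
  rewrite !double_face !aff_actM tE.
  case: b c {Gt tE} => -[] /=; rewrite ?mulr1n ?mulr0n ?addr0 ?aff_act_addw//.
  by rewrite addrA.
rewrite !double_last.
by case: b c {Gt tE} => -[] //=; rewrite opprB addrC subrK.
Qed.

Lemma double_inv u : double_group u ->
  exists2 v, double_group v & aff_mul v u = aff_id R m.+1.
Proof.
move=> [g [b [Gg ->]]]; have [h Gh hg] := bieb_inv GG Gg.
have hgK y : aff_act h (aff_act g y) = y by rewrite -aff_actM hg aff_act_id.
case: b.
  have [t Gt tw] := bieb_inv GG Gww.
  (* A flip is inverted by a flip up to the translation by [w + w], which [t] undoes. *)
  exists (double (aff_mul t h) true).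
    by exists (aff_mul t h), true; split => //; exact: bieb_mul.
  apply: aff_act_inj => x; rewrite aff_actM aff_act_id; apply: face_last_inj.
    rewrite !double_face !mulr1n aff_actM aff_act_addw// hgK.
    rewrite -aff_act_addw// -addrA.
    have -> : x *m E^T + (w + w) = aff_act (1%:M, w + w) (x *m E^T).
      by rewrite /aff_act /= mulmx1.
    by rewrite -aff_actM tw aff_act_id.
  by rewrite !double_last subKr.
exists (double h false); first by exists h, false.
apply: aff_act_inj => x; rewrite aff_actM aff_act_id; apply: face_last_inj.
  by rewrite !double_face !mulr0n !addr0 hgK.
by rewrite !double_last.
Qed.

Lemma double_id : double (aff_id R m) false = aff_id R m.+1.
Proof.
apply: aff_act_inj => x; apply: face_last_inj.
  by rewrite double_face !aff_act_id addr0.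
by rewrite double_last aff_act_id.
Qed.

(** Freeness is seen on the factor [R^m]: the reflection of the last coordinate fixes [s = 1], but a
    flipping element acts on [R^m] by [g] followed by [w], which has no fixed point by [w_free]. *)
Lemma double_free u x : double_group u -> aff_act u x = x -> u = aff_id R m.+1.
Proof.
move=> [g [b [Gg ->]]] /(congr1 (mulmx^~ E^T)); rewrite double_face.
case: b => [/w_free -/(_ Gg)//|]; rewrite addr0 => /(bieb_free GG Gg) ->.
exact: double_id.
Qed.

Lemma ball_face x x' (r : R) : ball x r x' -> ball (x *m E^T) r (x' *m E^T).
Proof.
by move=> [r0 xx']; split => // i j; rewrite !mul_face_tr; exact: xx'.
Qed.

(** The two factors are treated separately. On [R^m], the orbit of [G] is compared with the
    projection of [x'], shifted by [- w] for flips; the last coordinate takes only the values [s]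
    and [2 - s]. *)
Lemma double_discrete x x' : exists2 r : R, 0 < r & forall u, double_group u ->
  ball x' r (aff_act u x) -> aff_act u x = x'.
Proof.
have [r0 r00 r0P] := bieb_orbit_discrete GG (x *m E^T) (x' *m E^T).
have [r1 r10 r1P] := bieb_orbit_discrete GG (x *m E^T) (x' *m E^T - w).
have sep (s t : R) : exists2 r : R, 0 < r & `|t - s| < r -> s = t.
  have [->|st] := eqVneq s t; first by exists 1.
  by exists `|t - s|; rewrite ?ltxx// normr_gt0 subr_eq0 eq_sym.
have [r2 r20 r2P] := sep (x 0 ord_max) (x' 0 ord_max).
have [r3 r30 r3P] := sep (2 - x 0 ord_max) (x' 0 ord_max).
exists (Num.min (Num.min r0 r1) (Num.min r2 r3)).
  by rewrite !lt_min r00 r10 r20.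
move=> u [g [b [Gg ->]]] xu.
have xl := xu.2 0 ord_max; have xE := ball_face xu.
move: xl xE; rewrite double_last double_face.
rewrite -!ball_normE /= !lt_min => /andP[_ /andP[l2 l3]] /andP[/andP[f0 f1] _].
apply: face_last_inj; rewrite ?double_last ?double_face.
  case: b f0 f1 {xu l2 l3} => f0 f1.
    rewrite (r1P g Gg) ?subrK// -ball_normE /=.
    by rewrite addrAC -addrA -opprD.
  move: f0; rewrite mulr0n addr0 => f0.
  by apply: r0P => //; rewrite -ball_normE.
by case: b l2 l3 {xu f0 f1} => l2 l3; [exact: r3P|exact: r2P].
Qed.

Lemma double_cocompact : exists2 K : set 'rV[R]_m.+1, compact K &
  forall x, 0 <= x 0 ord_max <= 2 ->
    exists2 u, double_group u & K (aff_act u x).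
Proof.
have [K Kc KP] := bieb_cocompact GG.
exists ((fun p : 'rV[R]_m * R => p.1 *m E + p.2 *: e) @`
  (K `*` `[0, 2]%classic)).
  apply: continuous_compact; last first.
    by apply: compact_setX => //; exact: segment_compact.
  apply: continuous_subspaceT => p; apply: (@cvgD _ _ _ (nbhs p)).
    apply: (@continuous_comp _ _ _ fst (fun y : 'rV[R]_m => y *m E) p).
      exact: cvg_fst.
    exact: mulmxr_continuous.
  apply: (@continuous_comp _ _ _ snd (fun s : R => s *: e) p).
    exact: cvg_snd.
  exact: scalel_continuous.
move=> x x02; have [g Gg Kg] := KP (x *m E^T).
exists (double g false); first by exists g, false.
exists (aff_act g (x *m E^T), x 0 ord_max).
  by split => //=; rewrite in_itv.
by rewrite double_act /= addr0 mulr0n add0r mul1r.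
Qed.

Lemma double_slab_group : slab_group double_group.
Proof.
split.
- exact: double_isometry.
- by exists (aff_id R m), false; split; [exact: bieb_id|rewrite double_id].
- exact: double_mul.
- exact: double_inv.
- by move=> u [g [[] [Gg ->]]]; [right|left] => x; rewrite double_last.
- exists (double (aff_id R m) true); last by move=> x; rewrite double_last.
  by exists (aff_id R m), true; split => //; exact: bieb_id.
- exact: double_free.
- exact: double_discrete.
- exact: double_cocompact.
Qed.

Lemma double_bounds : bounds_compact_flat_manifold G.
Proof.
apply: (slab_group_bounds GG double_slab_group) => [g Gg|u y y'].
  exists (double g false); first by exists g, false.
  move=> y; rewrite double_act mul_face_last mulr0 mulr0n !addr0 scale0r addr0.
  by rewrite -mulmxA face_mxK mulmx1.
move=> [g [b [Gg ->]]] E0; exists g => //.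
(* Both points have [s = 0], while a flip would give [s = 2]; so the element comes from [G]
   alone. *)
have := congr1 (fun z : 'rV[R]_m.+1 => z 0 ord_max) E0.
rewrite double_last !mul_face_last; case: b E0 => E0.
  by rewrite subr0 => /eqP; rewrite pnatr_eq0.
move=> _; have := congr1 (mulmx^~ E^T) E0.
by rewrite double_face -!mulmxA face_mxK !mulmx1 addr0.
Qed.

End Double.

Theorem theorem4p1 (R : realType) (m : nat) (m_gt0 : (0 < m)%N)
    (G : set ('M[R]_m * 'rV[R]_m)) (k : nat) :
  bieberbach_group G ->
  holonomy_cyclic_of_order G k ->
  odd k ->
  bounds_compact_flat_manifold G.
Proof.
move=> GG hk ok.
have [w [Gww wG w_free]] := bieb_half_translation GG m_gt0 ok hk.
exact: (double_bounds GG Gww wG w_free).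
Qed.
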